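(* Consider the MPC closed loop with zone control and input targets (described in the context), with any input horizon $m$. Assume that the spectral radius of $F$ is strictly smaller than $1$, and that the input target $u_{des}$ is such that $u_{des}\in\mathbb{U}$ and $D_0u_{des}\in\mathbb{Y}$. Then the positive definite weighting matrix $S_u$ can be chosen large enough such that $$\lim_{k\to\infty}V_k^*=0 .$$
   Context: ''Large enough'' for symmetric matrices refers to the Loewner order ($A>B$ means $A-B$ is positive definite). Model. Let $F\in\mathbb{C}^{n_d\times n_d}$, $D_0\in\mathbb{R}^{n_y\times n_u}$, $D_d\in\mathbb{C}^{n_d\times n_u}$, $\Psi\in\mathbb{R}^{n_y\times n_d}$. For discrete times $k\ge 0$ the system has static state $x_s\in\mathbb{R}^{n_y}$, dynamic state $x_d\in\mathbb{C}^{n_d}$, input $u\in\mathbb{R}^{n_u}$ and (real) output $y\in\mathbb{R}^{n_y}$, with $$x_s(k+1)=x_s(k)+D_0(u(k+1)-u(k)),\quad x_d(k+1)=Fx_d(k)+D_d(u(k+1)-u(k)),\quad y(k)=x_s(k)+\Psi x_d(k).$$ At time $0$: $u(0)=0$, $x_s(0)=0$, $x_d(0)=0$. Predictions. Let $m\ge 1$ be an integer (input horizon). At each time step $k\ge 1$, a sequence of moves $\Delta u_k=(\Delta u(0|k),\dots,\Delta u(m-1|k))\in(\mathbb{R}^{n_u})^m$ is considered, with $\Delta u(j|k)=0$ for $j\ge m$. Starting from the actual values $u(k-1)$, $x_s(k-1)$, $x_d(k-1)$ (assigned to index $j=-1$), the predictions for $j\ge 0$ are $$x_s(j|k)=x_s(j-1|k)+D_0\Delta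 u(j|k),\quad x_d(j|k)=Fx_d(j-1|k)+D_d\Delta u(j|k),\quad y(j|k)=x_s(j|k)+\Psi x_d(j|k),$$ and $u(j|k)=u(k-1)+\sum_{i=0}^{j}\Delta u(i|k)$. Optimization problem. Let $u_{des}\in\mathbb{R}^{n_u}$ be the input target. The output set-point $y_{sp,k}\in\mathbb{R}^{n_y}$ and the slack vectors $\delta_{y,k}\in\mathbb{R}^{n_y}$, $\delta_{u,k}\in\mathbb{R}^{n_u}$ are decision variables. Let $Q_y,S_y\in\mathbb{R}^{n_y\times n_y}$ and $Q_u,R,S_u\in\mathbb{R}^{n_u\times n_u}$ be positive definite, and write $\|v\|_M^2=v^TMv$. The cost is $$V_k=\sum_{j=0}^{\infty}\|y(j|k)-y_{sp,k}-\delta_{y,k}\|_{Q_y}^2+\sum_{j=0}^{\infty}\|u(j|k)-u_{des}-\delta_{u,k}\|_{Q_u}^2+\sum_{j=0}^{m-1}\|\Delta u(j|k)\|_R^2+\|\delta_{y,k}\|_{S_y}^2+\|\delta_{u,k}\|_{S_u}^2 .$$ At each $k\ge 1$, $V_k$ is minimized over $(\Delta u_k,y_{sp,k},\delta_{y,k},\delta_{u,k})$ subject to $x_s(m-1|k)-y_{sp,k}-\delta_{y,k}=0$, $u(m-1|k)-u_{des}-\delta_{u,k}=0$, $u(k-1)+\sum_{j=0}^{i}\Delta u(j|k)\in\mathbb{U}$ for $0\le i<m$, $\Delta u(j|k)\in\Delta\mathbb{U}$ for $0\le j<m$, and $y_{sp,k}\in\mathbb{Y}$, where $\mathbb{U},\Delta\mathbb{U}$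 are fixed rectangles in $\mathbb{R}^{n_u}$ and $\mathbb{Y}$ is a fixed rectangle in $\mathbb{R}^{n_y}$, each containing the corresponding origin. The solution is unique; it is denoted $\Delta u_k^*,y_{sp,k}^*,\delta_{y,k}^*,\delta_{u,k}^*$, the corresponding optimal cost is $V_k^*$, and starred quantities $u^*,x_s^*,x_d^*,y^*$ are the ones obtained from it. Closed loop. Only the first move is implemented: the actual input, state and output at time $k$ are $u(k)=u^*(0|k)=\sum_{\ell=1}^{k}\Delta u^*(0|\ell)$, $x_s(k)=x_s^*(0|k)$, $x_d(k)=x_d^*(0|k)$, $y(k)=y^*(0|k)$, and the problem is then solved again at time $k+1$.
   Formalization: The rectangle ΔU is assumed to contain the origin in its interior, not merely as a member; otherwise the claim fails, e.g. ΔU=[0,1], U=Y=[-1,1], D_0=1, u_des=-1/2 keeps u(k)≥0 and V_k^* bounded away from 0. *)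

(* Defs.v *)
From HB Require Import structures.
From mathcomp Require Import all_boot all_order all_algebra.
From mathcomp Require Import complex.
From mathcomp Require Import all_classical all_reals all_analysis.

Set Implicit Arguments.
Unset Strict Implicit.
Unset Printing Implicit Defensive.

Import Order.TTheory GRing.Theory Num.Theory.
Import numFieldNormedType.Exports.

Local Open Scope classical_set_scope.
Local Open Scope ring_scope.

Section Matrices.
Variable R : realType.

Definition quad n (M : 'M[R]_n) (v : 'cV[R]_n) : R := (v^T *m M *m v) 0 0.

Definition posdef n (M : 'M[R]_n) : Prop :=
  M^T = M /\ forall v : 'cV[R]_n, v != 0 -> 0 < quad M v.

(* Strict Loewner order: A < B. *)
Definition loewner_lt n (A B : 'M[R]_n) : Prop := posdef (B - A).

Definition rectangle n (A : set 'cV[R]_n) : Prop :=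
  exists lo hi : 'cV[R]_n, A = [set x | forall i, lo i 0 <= x i 0 <= hi i 0].

(* [eigenvalue] is defined through left eigenvectors; a square matrix has the
   same left and right eigenvalues.  The supremum ranges over a finite set, and
   is 0 when n = 0. *)
Definition spectral_radius n (A : 'M[R[i]]_n) : R :=
  sup [set ComplexField.Normc.normc l | l in [set l : R[i] | eigenvalue A l]].

Definition cplx p q (A : 'M[R]_(p, q)) : 'M[R[i]]_(p, q) :=
  map_mx (real_complex R) A.

End Matrices.

Section Model.
Variables (R : realType) (nd nu ny : nat).

Record plant := Plant {
  pF : 'M[R[i]]_nd;
  pD0 : 'M[R]_(ny, nu);
  pDd : 'M[R[i]]_(nd, nu);
  pPsi : 'M[R]_(ny, nd) }.

(* The model produces a real output: for every real input sequence, the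
   trajectory of the dynamic state from rest satisfies Psi x_d(k) \in R^ny. *)
Definition real_output (P : plant) : Prop :=
  forall (u : nat -> 'cV[R]_nu) (xd : nat -> 'cV[R[i]]_nd),
    u 0%N = 0 -> xd 0%N = 0 ->
    (forall k, xd k.+1 = pF P *m xd k + pDd P *m cplx (u k.+1 - u k)) ->
  forall k, cplx (pPsi P) *m xd k \is a mxOver Num.real.

(* Under [real_output], the imaginary part of Psi x_d dropped here is 0 along
   every trajectory of the system. *)
Definition output (P : plant) (xs : 'cV[R]_ny) (xd : 'cV[R[i]]_nd) : 'cV[R]_ny :=
  xs + map_mx (@complex.Re R) (cplx (pPsi P) *m xd).

Record state := State {
  inp : 'cV[R]_nu;
  stat : 'cV[R]_ny;
  dyn : 'cV[R[i]]_nd }.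

Section Predictions.
Variables (P : plant) (s : state) (v : nat -> 'cV[R]_nu).

Definition u_pred (j : nat) : 'cV[R]_nu := inp s + \sum_(i < j.+1) v i.

Fixpoint xs_pred (j : nat) : 'cV[R]_ny :=
  (if j is i.+1 then xs_pred i else stat s) + pD0 P *m v j.

Fixpoint xd_pred (j : nat) : 'cV[R[i]]_nd :=
  pF P *m (if j is i.+1 then xd_pred i else dyn s) + pDd P *m cplx (v j).

Definition y_pred (j : nat) : 'cV[R]_ny := output P (xs_pred j) (xd_pred j).

End Predictions.

Record weights := Weights {
  wQy : 'M[R]_ny;
  wQu : 'M[R]_nu;
  wR : 'M[R]_nu;
  wSy : 'M[R]_ny;
  wSu : 'M[R]_nu }.

Section Problem.
Variable m : nat.

Record decision := Decision {
  moves : 'I_m -> 'cV[R]_nu;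
  ysp : 'cV[R]_ny;
  slack_y : 'cV[R]_ny;
  slack_u : 'cV[R]_nu }.

(* The moves, extended by 0 beyond the input horizon. *)
Definition move (d : decision) (j : nat) : 'cV[R]_nu :=
  if insub j is Some i then moves d i else 0.

Variables (P : plant) (U dU : set 'cV[R]_nu) (Y : set 'cV[R]_ny).
Variables (udes : 'cV[R]_nu) (W : weights).

(* Extended-real valued, since the two series have nonnegative terms but need
   not converge. *)
Definition cost (s : state) (d : decision) : \bar R :=
  (\sum_(0 <= j <oo)
     (quad (wQy W) (y_pred P s (move d) j - ysp d - slack_y d))%:E
   + \sum_(0 <= j <oo)
     (quad (wQu W) (u_pred s (move d) j - udes - slack_u d))%:E
   + (\sum_(j < m) quad (wR W) (moves d j))%:E
   + (quad (wSy W) (slack_y d))%:E + (quad (wSu W) (slack_u d))%:E)%E.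

Definition feasible (s : state) (d : decision) : Prop :=
  [/\ xs_pred P s (move d) m.-1 - ysp d - slack_y d = 0,
      u_pred s (move d) m.-1 - udes - slack_u d = 0,
      forall i, (i < m)%N -> U (u_pred s (move d) i),
      forall j, dU (moves d j)
    & Y (ysp d)].

Definition optimal (s : state) (d : decision) : Prop :=
  feasible s d /\ forall d', feasible s d' -> (cost s d <= cost s d')%E.

(* [s k] is the actual (u(k), x_s(k), x_d(k)); [d k] is the solution of the
   problem at time k >= 1, posed from [s k.-1] ([d 0] is irrelevant). *)
Definition closed_loop (s : nat -> state) (d : nat -> decision) : Prop :=
  s 0%N = State 0 0 0 /\
  forall k, optimal (s k) (d k.+1) /\
    s k.+1 = State (u_pred (s k) (move (d k.+1)) 0)
                   (xs_pred P (s k) (move (d k.+1)) 0)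
                   (xd_pred P (s k) (move (d k.+1)) 0).

End Problem.
End Model.

(* Main.v *)
Require Import Defs.
From HB Require Import structures.
From mathcomp Require Import all_boot all_order all_algebra.
From mathcomp Require Import complex.
From mathcomp Require Import all_classical all_reals all_analysis.
From mathcomp Require Import ring lra.

Set Implicit Arguments.
Unset Strict Implicit.
Unset Printing Implicit Defensive.

Import Order.TTheory GRing.Theory Num.Theory.
Import numFieldNormedType.Exports.

Local Open Scope classical_set_scope.
Local Open Scope ring_scope.

(** Two comparison inputs for the optimization problem carry the proof.

    The first one keeps the plan: dropping the implemented move of the optimal
    plan and appending a zero move gives a feasible plan for the next problem,
    whose cost is smaller by at least the first stage ([feasible_shift],
    [cost_shift]).  Hence V*_k is nonincreasing and the first stages tend to 0.
    By coercivity of positive definite forms, the implemented moves tend to 0,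
    and so does the gap between the actual input and the last planned one.  As
    F is stable, the dynamic state tends to 0 too.

    The second one moves to the target: a single move takes the input the
    fraction a of the way from u to u_des, the set-point the same fraction of
    the way to D_0 u_des, and nothing moves afterwards ([target_step]).  Both
    slacks shrink by the factor 1 - a, so their cost shrinks to (1 - a)^2 of
    its value, while moving costs only O(a^2) |u - u_des|^2 plus a
    multiple of the squared dynamic state ([cost_target_step]).  Up to the
    vanishing gap, u - u_des is the input slack, so |u - u_des|^2 is at most a
    multiple of V*_k.  A gain of first order in a beats a loss of second order:
    for a small, V*_(k+1) <= (1 - a/2) V*_k + r_k with r_k -> 0, and such a
    sequence tends to 0 ([cvg0_perturbed_contraction]).  One a serves for all k
    because U is bounded and dU is a neighbourhood of 0
    ([uniform_admissible_step]).

    The fraction a is chosen after S_u: a larger S_u allows a larger a, but some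
    a > 0 always exists, which is why the move weight can serve as threshold S0.

    Stability of F enters through a gauge N, equivalent to the l1 norm, with
    N (F x) <= q N x for some q < 1 ([stable_gauge]).  It is read off the
    factors F - l of the characteristic polynomial, whose product vanishes by
    the Cayley-Hamilton theorem. *)

(** * The l1 norm of complex vectors *)

Section L1Norm.
Variable R : realType.
Implicit Types (n p : nat) (a : R[i]).

Notation normc := ComplexField.Normc.normc.

Definition l1 n (x : 'cV[R[i]]_n) : R := \sum_i normc (x i 0).

Lemma normc_ge0 a : 0 <= normc a.
Proof. by case: a => x y /=; rewrite sqrtr_ge0. Qed.

Lemma normcr (x : R) : normc x%:C%C = `|x|.
Proof. by rewrite /= expr0n /= addr0 sqrtr_sqr. Qed.

Lemma normRe a : `|complex.Re a| <= normc a.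
Proof.
by case: a => x y /=; rewrite -sqrtr_sqr ler_wsqrtr // lerDl sqr_ge0.
Qed.

Lemma l1_ge0 n (x : 'cV[R[i]]_n) : 0 <= l1 x.
Proof. by apply: sumr_ge0 => i _; apply: normc_ge0. Qed.

Lemma l10 n : l1 (0 : 'cV[R[i]]_n) = 0.
Proof.
by rewrite /l1 big1 // => i _; rewrite mxE; exact: ComplexField.Normc.normc0.
Qed.

Lemma l1D n (x y : 'cV[R[i]]_n) : l1 (x + y) <= l1 x + l1 y.
Proof.
rewrite /l1 -big_split; apply: ler_sum => i _.
by rewrite mxE; apply: le_normcD.
Qed.

Lemma l1Z n a (x : 'cV[R[i]]_n) : l1 (a *: x) = normc a * l1 x.
Proof.
rewrite /l1 mulr_sumr; apply: eq_bigr => i _.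
by rewrite mxE ComplexField.Normc.normcM.
Qed.

Lemma normc_entry_le_l1 n (x : 'cV[R[i]]_n) i : normc (x i 0) <= l1 x.
Proof.
by rewrite /l1 (bigD1 i) //= lerDl; apply: sumr_ge0 => j _; apply: normc_ge0.
Qed.

Lemma normc_sum (I : Type) (r : seq I) (f : I -> R[i]) :
  normc (\sum_(i <- r) f i) <= \sum_(i <- r) normc (f i).
Proof.
elim: r => [|i r IH]; first by rewrite !big_nil ComplexField.Normc.normc0.
by rewrite !big_cons; apply: le_trans (le_normcD _ _) _; rewrite lerD2l.
Qed.

Lemma l1_mulmx p n (A : 'M[R[i]]_(p, n)) :
  exists2 c, 0 <= c & forall x, l1 (A *m x) <= c * l1 x.
Proof.
exists (\sum_i \sum_j normc (A i j)).
  by do 2![apply: sumr_ge0 => ? _]; apply: normc_ge0.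
move=> x; rewrite /l1 mulr_suml; apply: ler_sum => i _.
rewrite mxE mulr_suml; apply: le_trans (normc_sum _ _) _.
apply: ler_sum => j _; rewrite ComplexField.Normc.normcM.
by rewrite ler_wpM2l ?normc_ge0 ?normc_entry_le_l1.
Qed.

(** * A vector gauge that contracts along a stable matrix *)

(** On the vectors x killed by the product of the factors F - l, a weighted sum
    of the norms of x, (F - l1) x, (F - l2) (F - l1) x, ... contracts along F:
    each term is multiplied by some |l| < 1 and receives the next term, whose
    larger weight absorbs it. *)
Lemma contraction_gauge n (F : 'M[R[i]]_n) (rs : seq R[i]) :
    all (fun l => normc l < 1) rs ->
  exists (N : 'cV[R[i]]_n -> R) (q C : R),
    [/\ 0 <= q < 1, 0 <= C,
        (forall x, 0 <= N x <= C * l1 x),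
        (forall x y, N (x + y) <= N x + N y)
      & forall x, \big[mulmx/1%:M]_(l <- rs) (F - l%:M) *m x = 0 ->
        l1 x <= N x /\ N (F *m x) <= q * N x].
Proof.
elim: rs => [_|l rs IH /= /andP[l_lt1 /IH]].
  exists (fun=> 0), 0, 0; split => //; rewrite ?lexx ?ltr01 //.
  - by move=> x; rewrite mul0r lexx.
  - by move=> x; rewrite big_nil mul1mx => ->; rewrite l10 mulr0.
move=> [N [q [C [/andP[q0 q1] C0 NC ND Nrs]]]].
pose G := F - l%:M; have [g g0 hg] := l1_mulmx G.
(* With this t, absorbing the coupling l1 (G x) <= N (G x) raises the factor q
   of the t-weighted term only to (1 + q) / 2. *)
have [t t0 tq] : exists2 t, 0 < t & 1 + t * q = t * ((1 + q) / 2).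
  exists (2 / (1 - q)); first by rewrite divr_gt0 ?subr_gt0.
  by field; lra.
pose r := Num.max (normc l) ((1 + q) / 2).
exists (fun x => l1 x + t * N (G *m x)), r, (1 + t * (C * g)); split.
- by rewrite /r le_max gt_max l_lt1 normc_ge0 /=; lra.
- by rewrite addr_ge0 // mulr_ge0 ?(ltW t0) // mulr_ge0.
- move=> x; have /andP[N0 N1] := NC (G *m x); apply/andP; split.
    by rewrite addr_ge0 ?l1_ge0 // mulr_ge0 // ltW.
  rewrite mulrDl mul1r lerD2l -!mulrA ler_pM2l //.
  by rewrite (le_trans N1) // ler_wpM2l.
- move=> x y; rewrite mulmxDr addrACA -mulrDr; apply: lerD; first exact: l1D.
  by rewrite ler_pM2l.
- move=> x; rewrite big_cons => hx.
  have comm : F *m G = G *m F by rewrite mulmxBr mulmxBl scalar_mxC.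
  have commrs : \big[mulmx/1%:M]_(l <- rs) (F - l%:M) *m G =
      G *m \big[mulmx/1%:M]_(l <- rs) (F - l%:M).
    elim: (rs) => [|k s IHs]; first by rewrite big_nil mul1mx mulmx1.
    rewrite big_cons -mulmxA IHs !mulmxA; congr (_ *m _).
    rewrite /G !mulmxBl !mulmxBr !mul_scalar_mx !mul_mx_scalar.
    rewrite !scale_scalar_mx mulrC !opprB ![_ *m F - _ + _]addrACA.
    by congr (_ + _); rewrite addrC.
  have [|l1N NF] := Nrs (G *m x); first by rewrite mulmxA commrs.
  have N0 : 0 <= N (G *m x) by case/andP: (NC (G *m x)).
  split; first by rewrite lerDl mulr_ge0 // ltW.
  have -> : G *m (F *m x) = F *m (G *m x) by rewrite !mulmxA comm.
  have -> : F *m x = l *: x + G *m x.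
    by rewrite mulmxBl mul_scalar_mx addrC subrK.
  apply: le_trans (_ : normc l * l1 x + t * ((1 + q) / 2) * N (G *m x) <= _).
    rewrite -tq; have := l1D (l *: x) (G *m x); rewrite l1Z => h.
    have : t * N (F *m (G *m x)) <= t * (q * N (G *m x)) by rewrite ler_pM2l.
    lra.
  rewrite mulrDr; apply: lerD.
    by rewrite ler_wpM2r ?l1_ge0 // /r le_max lexx.
  rewrite [leRHS]mulrA ler_wpM2r // mulrC ler_pM2r //.
  by rewrite /r le_max lexx orbT.
Qed.

Lemma eigenvalue_le_spectral_radius n (F : 'M[R[i]]_n) l :
  eigenvalue F l -> normc l <= spectral_radius F.
Proof.
move=> Fl; apply: ub_le_sup; last by exists l.
have [rs hrs] := closed_field_poly_normal (char_poly F).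
exists (\sum_(z <- rs) normc z) => _ [k /= Fk <-].
have : k \in rs.
  move: Fk; rewrite eigenvalue_root_char hrs (monicP (char_poly_monic F)).
  by rewrite scale1r root_prod_XsubC.
move=> krs; rewrite (big_rem k) //= lerDl.
by apply: sumr_ge0 => z _; apply: normc_ge0.
Qed.

Lemma stable_gauge n (F : 'M[R[i]]_n) : spectral_radius F < 1 ->
  exists (N : 'cV[R[i]]_n -> R) (q C : R),
    [/\ 0 <= q < 1, 0 <= C,
        (forall x, l1 x <= N x <= C * l1 x),
        (forall x y, N (x + y) <= N x + N y)
      & forall x, N (F *m x) <= q * N x].
Proof.
move=> F1; have [rs hrs] := closed_field_poly_normal (char_poly F).
rewrite (monicP (char_poly_monic F)) scale1r in hrs.
have rs1 : all (fun l => normc l < 1) rs.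
  apply/allP => l lrs; apply: le_lt_trans F1.
  apply: eigenvalue_le_spectral_radius.
  by rewrite eigenvalue_root_char hrs root_prod_XsubC.
have [N [q [C [q01 C0 NC ND Nrs]]]] := contraction_gauge F rs1.
have kill (x : 'cV_n) : \big[mulmx/1%:M]_(l <- rs) (F - l%:M) *m x = 0.
  case: n F F1 rs hrs rs1 N NC ND Nrs x => [|n] F _ rs hrs _ _ _ _ _ x.
    by apply/matrixP => -[].
  have -> : \big[mulmx/1%:M]_(l <- rs) (F - l%:M) = horner_mx F (char_poly F).
    rewrite hrs rmorph_prod /=; apply: eq_bigr => l _.
    by rewrite rmorphB /= horner_mx_X horner_mx_C.
  by rewrite Cayley_Hamilton mul0mx.
exists N, q, C; split => // x; have [l1N NF] := Nrs x (kill x) => //.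
by rewrite l1N; case/andP: (NC x).
Qed.

End L1Norm.

(** * Quadratic forms *)

Section QuadraticForms.
Variable R : realType.
Implicit Types n p : nat.

Definition bil n (M : 'M[R]_n) (v w : 'cV[R]_n) : R := (v^T *m M *m w) 0 0.

Lemma quadD n (M : 'M[R]_n) v w : M^T = M ->
  quad M (v + w) = quad M v + bil M v w *+ 2 + quad M w.
Proof.
move=> MT; have -> : bil M v w *+ 2 = bil M v w + bil M w v.
  rewrite mulr2n; congr (_ + _).
  by rewrite /bil -[w^T *m M *m v]trmxK [RHS]mxE !trmx_mul trmxK MT mulmxA.
by rewrite /quad /bil [(v + w)^T]linearD /= !mulmxDl !mulmxDr !mxE -!addrA;
  congr (_ + _); rewrite addrCA.
Qed.

Lemma quadZ n (M : 'M[R]_n) a v : quad M (a *: v) = a ^+ 2 * quad M v.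
Proof.
by rewrite /quad [(a *: v)^T]linearZ /= -scalemxAr -!scalemxAl !mxE !mulrA.
Qed.

Lemma bilZ n (M : 'M[R]_n) a b v w :
  bil M (a *: v) (b *: w) = a * b * bil M v w.
Proof.
rewrite /bil [(a *: v)^T]linearZ /= -scalemxAr -!scalemxAl !mxE !mulrA.
by rewrite [b * a]mulrC.
Qed.

Lemma quad0 n (M : 'M[R]_n) : quad M 0 = 0.
Proof. by rewrite /quad mulmx0 mxE. Qed.

Lemma quad_mulmx n p (M : 'M[R]_p) (A : 'M[R]_(p, n)) v :
  quad M (A *m v) = quad (A^T *m M *m A) v.
Proof. by rewrite /quad trmx_mul !mulmxA. Qed.

Lemma quad_ge0 n (M : 'M[R]_n) v : posdef M -> 0 <= quad M v.
Proof.
by move=> [_ Mpos]; have [->|/Mpos/ltW//] := eqVneq v 0; rewrite quad0.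
Qed.

(** Weighted Young inequality; the weight t makes the constant in front of the
    main term v as close to 1 as needed. *)
Lemma quad_young n (M : 'M[R]_n) t v w : posdef M -> 0 < t ->
  quad M (v + w) <= (1 + t) * quad M v + (1 + t^-1) * quad M w.
Proof.
move=> Mpos t0; have := quad_ge0 (t *: v + (-1) *: w) Mpos.
have [MT _] := Mpos; rewrite !quadD // !quadZ bilZ sqrrN expr1n => h.
have : 0 <= t * quad M v + t^-1 * quad M w - bil M v w *+ 2.
  rewrite -(pmulr_rge0 _ t0); apply: le_trans h _.
  by rewrite le_eqVlt; apply/orP; left; apply/eqP; field; lra.
lra.
Qed.

Lemma quad_cauchy_schwarz n (M : 'M[R]_n) v w : posdef M ->
  bil M v w ^+ 2 <= quad M v * quad M w.
Proof.
move=> Mpos; have [MT Mgt] := Mpos.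
have [->|/Mgt w0] := eqVneq w 0.
  by rewrite /bil mulmx0 mxE quad0 mulr0 expr0n.
have := quad_ge0 (quad M w *: v + (- bil M v w) *: w) Mpos.
rewrite quadD // !quadZ bilZ => h.
rewrite -subr_ge0 -(pmulr_rge0 _ w0); apply: le_trans h _.
by rewrite le_eqVlt; apply/orP; left; apply/eqP; ring.
Qed.

Lemma posdef_unitmx n (M : 'M[R]_n) : posdef M -> M \in unitmx.
Proof.
move=> [_ Mpos]; rewrite unitmxE unitfE; apply/det0P => -[v v0 vM].
have /Mpos : v^T != 0 by rewrite -trmx0 (inj_eq trmx_inj).
by rewrite /quad trmxK vM mul0mx mxE ltxx.
Qed.

Lemma l1_cplxE n (v : 'cV[R]_n) : l1 (cplx v) = \sum_i `|v i 0|.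
Proof. by apply: eq_bigr => i _; rewrite mxE normcr. Qed.

Lemma l1_Re n (x : 'cV[R[i]]_n) : l1 (cplx (map_mx (@complex.Re R) x)) <= l1 x.
Proof.
by rewrite l1_cplxE; apply: ler_sum => i _; rewrite mxE normRe.
Qed.

(** The i-th coordinate of v is the M-inner product of v with the fixed vector
    M^-1 e_i, so the Cauchy-Schwarz inequality bounds it. *)
Lemma posdef_coercive n (M : 'M[R]_n) : posdef M ->
  exists2 c, 0 <= c & forall v, l1 (cplx v) ^+ 2 <= c * quad M v.
Proof.
move=> Mpos; have [MT _] := Mpos.
pose w i := invmx M *m delta_mx i 0 : 'cV[R]_n.
have entry (v : 'cV[R]_n) i : v i 0 = bil M (w i) v.
  rewrite /bil -[(w i)^T *m M]trmxK trmx_mul trmxK MT /w.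
  by rewrite mulKVmx ?posdef_unitmx // trmx_delta -rowE mxE.
exists ((\sum_i Num.sqrt (quad M (w i))) ^+ 2); first exact: sqr_ge0.
move=> v; rewrite -[quad M v]sqr_sqrtr ?quad_ge0 // -exprMn.
rewrite ler_pXn2r ?nnegrE ?l1_ge0 ?mulr_ge0 ?sqrtr_ge0 //; last first.
  by apply: sumr_ge0 => i _; rewrite sqrtr_ge0.
rewrite l1_cplxE mulr_suml; apply: ler_sum => i _.
rewrite -sqrtrM ?quad_ge0 // -sqrtr_sqr ler_wsqrtr // entry.
exact: quad_cauchy_schwarz.
Qed.

Lemma quad_le_l1 n (M : 'M[R]_n) :
  exists2 c, 0 <= c & forall v, quad M v <= c * l1 (cplx v) ^+ 2.
Proof.
exists (\sum_j \sum_i `|M i j|).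
  by do 2![apply: sumr_ge0 => ? _].
have entry (v : 'cV[R]_n) i : `|v i 0| <= l1 (cplx v).
  by have := normc_entry_le_l1 (cplx v) i; rewrite mxE normcr.
move=> v; rewrite /quad mxE mulr_suml; apply: ler_sum => j _.
rewrite mxE !mulr_suml; apply: ler_sum => i _; rewrite mxE.
apply: le_trans (ler_norm _) _; rewrite !normrM mulrAC mulrC expr2.
by rewrite ler_wpM2l // ler_pM.
Qed.

End QuadraticForms.

(** * Sequences and series *)

Section Analysis.
Variable R : realType.

(** From the moment K when r <= e/2 (1 - q), the excess of a over the fixed
    point e/2 of the recursion decays geometrically. *)
Lemma cvg0_perturbed_contraction (q : R) (a r : R^nat) :
    0 <= q < 1 -> (forall k, 0 <= a k) ->
    (forall k, a k.+1 <= q * a k + r k) -> r @ \oo --> 0 -> a @ \oo --> 0.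
Proof.
move=> /andP[q0 q1] a0 ar r0; apply/cvgrPdist_le => e e0.
have /cvgrPdist_le/(_ (e / 2 * (1 - q))) := r0.
rewrite mulr_gt0 ?divr_gt0 ?subr_gt0 // => /(_ isT)[K _ rK].
have aK n : a (K + n)%N <= e / 2 + q ^+ n * a K.
  elim: n => [|n IH]; first by rewrite addn0 mul1r lerDr divr_ge0 ?ltW.
  rewrite addnS; apply: le_trans (ar _) _.
  have := rK (K + n)%N (leq_addr _ _); rewrite /= sub0r normrN => rle.
  have := le_trans (ler_norm _) rle; have := ler_wpM2l q0 IH.
  rewrite exprS -mulrA mulrDr; lra.
have : (fun n => q ^+ n * a K) @ \oo --> (0 : R).
  by rewrite -(mul0r (a K)); apply: cvgMl; apply: cvg_expr; rewrite ger0_norm.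
move=> /cvgrPdist_le/(_ (e / 2)); rewrite divr_gt0 // => /(_ isT)[J _ qJ].
exists (K + J)%N => // k /= KJk; rewrite sub0r normrN ger0_norm //.
have Kk : (K <= k)%N by apply: leq_trans KJk; rewrite leq_addr.
have := qJ (k - K)%N; rewrite /= leq_subRL // => /(_ KJk).
rewrite sub0r normrN => h; have := le_trans (ler_norm _) h.
by have := aK (k - K)%N; rewrite subnKC //; lra.
Qed.

Lemma nneseries_le_geometric (f : nat -> R) (c q : R) :
    0 <= q < 1 -> (forall j, 0 <= f j <= c * q ^+ j) ->
  (\sum_(0 <= j <oo) (f j)%:E <= (c / (1 - q))%:E)%E.
Proof.
move=> /andP[q0 q1] fc.
have c0 : 0 <= c.
  by have /andP[h1 h2] := fc 0%N; rewrite expr0 mulr1 in h2; exact: le_trans h2.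
apply: lime_le.
  by apply: is_cvg_nneseries => j _ _; rewrite lee_fin; case/andP: (fc j).
apply: nearW => n; rewrite sumEFin lee_fin.
suff : \sum_(0 <= j < n) f j <= c / (1 - q) * (1 - q ^+ n).
  move=> /le_trans; apply; rewrite ler_piMr ?divr_ge0 ?subr_ge0 ?(ltW q1) //.
  by rewrite lerBlDr lerDl exprn_ge0.
elim: n => [|n IH]; first by rewrite big_nil subrr mulr0.
rewrite big_nat_recr //=; have /andP[_ fn] := fc n.
have -> : c / (1 - q) * (1 - q ^+ n.+1) =
    c / (1 - q) * (1 - q ^+ n) + c * q ^+ n.
  by rewrite exprS; field; lra.
exact: lerD.
Qed.

End Analysis.

(** * Rectangles *)

Section Rectangles.
Variable R : realType.
Implicit Types n : nat.

Lemma rectangle_convex n (A : set 'cV[R]_n) x y a : rectangle A ->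
  A x -> A y -> 0 <= a <= 1 -> A ((1 - a) *: x + a *: y).
Proof.
move=> [lo [hi ->]] /= Ax Ay /andP[a0 a1] i; rewrite !mxE.
have /andP[xl xh] := Ax i; have /andP[yl yh] := Ay i.
have b0 : 0 <= 1 - a by rewrite subr_ge0.
have := ler_wpM2l b0 xl; have := ler_wpM2l b0 xh.
have := ler_wpM2l a0 yl; have := ler_wpM2l a0 yh.
by move=> *; apply/andP; split; lra.
Qed.

(** Since U is bounded and B is a neighbourhood of 0, one fraction of the way
    towards the target is an admissible move from every point of U. *)
Lemma uniform_admissible_step n (U B : set 'cV[R]_n) t :
    rectangle U -> U t -> interior B 0 ->
  exists2 a0, 0 < a0 &
    forall a u, 0 <= a <= a0 -> U u -> B (- (a *: (u - t))).
Proof.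
move=> [lo [hi ->]] /= Ut /nbhs_ballP[r /= r0 rB].
pose D := \sum_i `|hi i 0 - lo i 0|.
have D0 : 0 <= D by apply: sumr_ge0.
exists (r / (D + 1)); first by rewrite divr_gt0 // ltr_wpDl.
move=> a u /andP[a0 ar] Uu; apply: rB; split=> // i j.
rewrite ord1 !mxE /ball /=.
rewrite sub0r opprK normrM ger0_norm //.
have uD : `|u i 0 - t i 0| <= D.
  apply: (@le_trans _ _ `|hi i 0 - lo i 0|).
    have /andP[ul uh] := Uu i; have /andP[tl th] := Ut i.
    have -> : `|hi i 0 - lo i 0| = hi i 0 - lo i 0 by apply: ger0_norm; lra.
    by rewrite ler_norml; apply/andP; split; lra.
  by rewrite /D (bigD1 i) //= lerDl; apply: sumr_ge0.
rewrite ler_pdivlMr ?ltr_wpDl // in ar.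
have [->|a_neq0] := eqVneq a 0; first by rewrite mul0r.
have apos : 0 < a by rewrite lt_neqAle eq_sym a_neq0.
have : a * `|u i 0 - t i 0| <= a * D by rewrite ler_pM2l.
lra.
Qed.

End Rectangles.

(** * Predictions *)

Section Predictions.
Variables (R : realType) (nd nu ny : nat) (P : plant R nd nu ny).
Implicit Types (s : state R nd nu ny) (v : nat -> 'cV[R]_nu).

Definition next_state s v : state R nd nu ny :=
  State (u_pred s v 0) (xs_pred P s v 0) (xd_pred P s v 0).

Lemma u_predS s v j : u_pred s v j.+1 = u_pred s v j + v j.+1.
Proof. by rewrite /u_pred big_ord_recr /= addrA. Qed.

Lemma u_pred0 s v : u_pred s v 0 = inp s + v 0%N.
Proof. by rewrite /u_pred big_ord_recr big_ord0 /= add0r. Qed.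

Lemma u_pred_next s v j :
  u_pred (next_state s v) (fun i => v i.+1) j = u_pred s v j.+1.
Proof.
elim: j => [|j IH]; first by rewrite u_pred0 u_predS.
by rewrite u_predS IH [RHS]u_predS.
Qed.

Lemma xs_pred_next s v j :
  xs_pred P (next_state s v) (fun i => v i.+1) j = xs_pred P s v j.+1.
Proof. by elim: j => [|j /= ->]. Qed.

Lemma xd_pred_next s v j :
  xd_pred P (next_state s v) (fun i => v i.+1) j = xd_pred P s v j.+1.
Proof. by elim: j => [|j /= ->]. Qed.

Lemma y_pred_next s v j :
  y_pred P (next_state s v) (fun i => v i.+1) j = y_pred P s v j.+1.
Proof. by rewrite /y_pred xs_pred_next xd_pred_next. Qed.

(** From rest, the static state of the closed loop is D_0 times its input;
    predictions preserve this relation. *)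
Lemma xs_predE s v j : stat s = pD0 P *m inp s ->
  xs_pred P s v j = pD0 P *m u_pred s v j.
Proof.
move=> hs; elim: j => [|j IH]; first by rewrite u_pred0 mulmxDr -hs.
by rewrite u_predS mulmxDr -IH.
Qed.

End Predictions.

Section Moves.
Variables (R : realType) (nu ny m : nat).
Implicit Types d : decision R nu ny m.

Lemma move_ord d (i : 'I_m) : move d i = moves d i.
Proof. by rewrite /move valK. Qed.

Lemma move_out d j : (m <= j)%N -> move d j = 0.
Proof. by move=> mj; rewrite /move insubN // -leqNgt. Qed.

Definition shift d : decision R nu ny m :=
  Decision (fun i => move d i.+1) (ysp d) (slack_y d) (slack_u d).

Lemma move_shift d : move (shift d) = fun j => move d j.+1.
Proof.
apply: funext => j; have [jm|mj] := ltnP j m.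
  by rewrite -[j]/(val (Ordinal jm)) move_ord.
by rewrite !move_out // ltnW.
Qed.

Definition single_move (w : 'cV[R]_nu) y sy su : decision R nu ny m :=
  Decision (fun i => if i == 0%N :> nat then w else 0) y sy su.

Lemma move_single w y sy su : (0 < m)%N ->
  move (single_move w y sy su) = fun j => if j == 0%N then w else 0.
Proof.
move=> m0; apply: funext => j; have [jm|mj] := ltnP j m.
  by rewrite -[j]/(val (Ordinal jm)) move_ord.
by rewrite move_out // gtn_eqF // (leq_trans m0).
Qed.

End Moves.

Lemma nneseries_head (R : realType) (f : nat -> \bar R) :
    (forall j, 0 <= f j)%E ->
  (\sum_(0 <= j <oo) f j = f 0%N + \sum_(0 <= j <oo) f j.+1)%E.
Proof.
move=> f0; rewrite nneseries_recl // -(nneseries_addn 1) //.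
by congr (_ + _)%E; apply: eq_eseriesr => j _; rewrite addn1.
Qed.

(** * The optimal cost does not increase *)

Section Shift.
Variables (R : realType) (nd nu ny m : nat) (P : plant R nd nu ny).
Variables (U dU : set 'cV[R]_nu) (Y : set 'cV[R]_ny) (udes : 'cV[R]_nu).
Variable W : weights R nu ny.
Hypotheses (m_gt0 : (0 < m)%N) (dU0 : dU 0).
Hypotheses (Qy_pos : posdef (wQy W)) (Qu_pos : posdef (wQu W)).
Implicit Types (s : state R nd nu ny) (d : decision R nu ny m).

Lemma u_pred_end s d : u_pred s (move d) m = u_pred s (move d) m.-1.
Proof.
have := u_predS s (move d) m.-1.
by rewrite prednK // (move_out d (leqnn m)) addr0.
Qed.

Lemma xs_pred_end s d : xs_pred P s (move d) m = xs_pred P s (move d) m.-1.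
Proof.
have : xs_pred P s (move d) m.-1.+1 =
  xs_pred P s (move d) m.-1 + pD0 P *m move d m.-1.+1 by [].
by rewrite prednK // (move_out d (leqnn m)) mulmx0 addr0.
Qed.

(** Keeping the plan stays feasible since nothing moves after the input horizon:
    the terminal input and static state are those of the previous plan, and the
    appended move is 0. *)
Lemma feasible_shift s d : feasible P U dU Y udes s d ->
  feasible P U dU Y udes (next_state P s (move d)) (shift d).
Proof.
move=> [hx hu hU hdU hY]; split => //; rewrite ?move_shift.
- by rewrite xs_pred_next prednK // xs_pred_end.
- by rewrite u_pred_next prednK // u_pred_end.
- move=> i im; rewrite u_pred_next; have [/hU//|mi] := ltnP i.+1 m.
  have -> : i.+1 = m by apply/eqP; rewrite eqn_leq im mi.
  by rewrite u_pred_end; apply: hU; rewrite prednK.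
- move=> j /=; have [jm|mj] := ltnP j.+1 m; last by rewrite move_out.
  by rewrite -[j.+1]/(val (Ordinal jm)) move_ord.
Qed.

Lemma cost_shift s d :
  (cost P udes W (next_state P s (move d)) (shift d) +
     (quad (wQu W) (u_pred s (move d) 0 - udes - slack_u d)
      + quad (wR W) (move d 0))%:E <= cost P udes W s d)%E.
Proof.
rewrite /cost move_shift.
rewrite [X in (_ <= X + _ + _ + _ + _)%E]nneseries_head; last first.
  by move=> j; rewrite lee_fin quad_ge0.
rewrite [X in (_ <= _ + X + _ + _ + _)%E]nneseries_head; last first.
  by move=> j; rewrite lee_fin quad_ge0.
under eq_eseriesr do rewrite y_pred_next.
under [X in (_ + X + _ + _ + _ + _ <= _)%E]eq_eseriesr do rewrite u_pred_next.
have sumR : \sum_(j < m) quad (wR W) (moves d j) =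
    \sum_(j < m) quad (wR W) (moves (shift d) j) + quad (wR W) (move d 0).
  pose f j := quad (wR W) (move d j).
  rewrite (eq_bigr (f \o val)) /= => [|j _]; last by rewrite /f move_ord.
  rewrite [X in X + _](eq_bigr (fun j : 'I_m => f j.+1)) //.
  rewrite -[quad _ (move d 0)]/(f 0%N) addrC -(big_ord_recl m f).
  rewrite big_ord_recr /=.
  by rewrite /f (move_out d (leqnn m)) quad0 addr0.
rewrite sumR /=.
set A := \big[_/_]_(0 <= i <oo) _; set B := \big[_/_]_(0 <= i <oo) _.
have Qy0 := quad_ge0 (y_pred P s (move d) 0 - ysp d - slack_y d) Qy_pos.
case: A => [A| |]; case: B => [B| |]; rewrite ?leey ?leNye //=.
by rewrite -!EFinD lee_fin; lra.
Qed.

End Shift.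

(** * A step towards the target *)

Section TargetStep.
Variables (R : realType) (nd nu ny m : nat) (P : plant R nd nu ny).
Variables (U dU : set 'cV[R]_nu) (Y : set 'cV[R]_ny) (udes : 'cV[R]_nu).
Variable W : weights R nu ny.
Hypotheses (m_gt0 : (0 < m)%N) (U_rect : rectangle U) (Y_rect : rectangle Y).
Hypotheses (dU0 : dU 0) (Uudes : U udes) (Yudes : Y (pD0 P *m udes)).
Hypothesis Qy_pos : posdef (wQy W).
Implicit Types (s : state R nd nu ny) (a : R).

(** Whatever the fraction a, the terminal constraints determine the slacks,
    because the static state follows the input; the set-point y only has to be
    any point of Y, and the previous optimal one is used below. *)
Definition target_step s y a : decision R nu ny m :=
  single_move m (- (a *: (inp s - udes)))
    ((1 - a) *: y + a *: (pD0 P *m udes))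
    ((1 - a) *: (pD0 P *m inp s - y))
    ((1 - a) *: (inp s - udes)).

Lemma u_pred_target_step s y a j :
  u_pred s (move (target_step s y a)) j = (1 - a) *: inp s + a *: udes.
Proof.
rewrite move_single //; elim: j => [|j IH]; last by rewrite u_predS IH addr0.
rewrite u_pred0 /= scalerBr scalerBl scale1r opprB -addrA; congr (_ + _).
exact: addrC.
Qed.

Lemma feasible_target_step s y a : stat s = pD0 P *m inp s ->
    U (inp s) -> Y y -> 0 <= a <= 1 -> dU (- (a *: (inp s - udes))) ->
  feasible P U dU Y udes s (target_step s y a).
Proof.
move=> hs Us Yy a01 dUa; split.
- rewrite xs_predE // u_pred_target_step /= mulmxDr -!scalemxAr.
  move: (pD0 P *m inp s) (pD0 P *m udes) => x t.
  by apply/matrixP => i j; rewrite !mxE; ring.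
- rewrite u_pred_target_step /=.
  by apply/matrixP => i j; rewrite !mxE; ring.
- by move=> i _; rewrite u_pred_target_step; apply: rectangle_convex.
- by move=> j /=; case: ifP.
- exact: rectangle_convex.
Qed.

(** The static part of the output is at its terminal value at once, so the
    output error is the decaying response of the dynamic state. *)
Lemma output_error_target_step s y a j : stat s = pD0 P *m inp s ->
  let d := target_step s y a in
  y_pred P s (move d) j - ysp d - slack_y d =
  pPsi P *m map_mx (@complex.Re R) (xd_pred P s (move d) j).
Proof.
move=> hs d; rewrite /y_pred /output xs_predE // u_pred_target_step /=.
have -> : map_mx (@complex.Re R) (cplx (pPsi P) *m xd_pred P s (move d) j) =
    pPsi P *m map_mx (@complex.Re R) (xd_pred P s (move d) j).
  apply/matrixP => i k; rewrite !mxE raddf_sum; apply: eq_bigr => l _.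
  by rewrite !mxE; case: (xd_pred _ _ _ _ _ _) => x z /=; rewrite mul0r subr0.
rewrite mulmxDr -!scalemxAr.
move: (pPsi P *m _) (pD0 P *m inp s) (pD0 P *m udes) => z x t.
by apply/matrixP => i k; rewrite !mxE; ring.
Qed.

Variables (N : 'cV[R[i]]_nd -> R) (q C : R).
Hypotheses (q01 : 0 <= q < 1) (C0 : 0 <= C).
Hypothesis NC : forall x, l1 x <= N x <= C * l1 x.
Hypothesis ND : forall x y, N (x + y) <= N x + N y.
Hypothesis NF : forall x, N (pF P *m x) <= q * N x.

(** The input error vanishes, the output error is summed by the gauge as a
    geometric series, and the slacks have shrunk by the factor 1 - a. *)
Lemma cost_target_step : exists2 K, 0 <= K &
  forall s y a, stat s = pD0 P *m inp s ->
  (cost P udes W s (target_step s y a) <=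
    (K * (N (dyn s) ^+ 2 + a ^+ 2 * l1 (cplx (inp s - udes)) ^+ 2)
     + (1 - a) ^+ 2 * (quad (wSy W) (pD0 P *m inp s - y)
                       + quad (wSu W) (inp s - udes)))%:E)%E.
Proof.
have [q0 q1] := andP q01.
have N0 x : 0 <= N x.
  by case/andP: (NC x) => h _; apply: le_trans h; exact: l1_ge0.
have [cy cy0 hy] := quad_le_l1 ((pPsi P)^T *m wQy W *m pPsi P).
have [cr cr0 hr] := quad_le_l1 (wR W).
have [cd cd0 hd] := l1_mulmx (pDd P).
pose K1 := cy / (1 - q); have K10 : 0 <= K1 by rewrite divr_ge0 // subr_ge0 ltW.
exists (K1 * (2 + 2 * (C * cd) ^+ 2) + cr).
  by rewrite addr_ge0 // mulr_ge0 // addr_ge0 // mulr_ge0 // sqr_ge0.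
move=> s y a hs; set d := target_step s y a.
have movE : move d = _ := move_single _ _ _ _ m_gt0.
pose x j := xd_pred P s (move d) j.
set e := l1 (cplx (inp s - udes)); have e0 : 0 <= e by apply: l1_ge0.
have Nx j : N (x j) <= q ^+ j * N (x 0%N).
  elim: j => [|j IH]; first by rewrite mul1r.
  have -> : x j.+1 = pF P *m x j.
    rewrite /x /= movE /= /cplx map_mx0 mulmx0 addr0.
    by congr (_ *m xd_pred _ _ _ _); rewrite movE.
  by rewrite (le_trans (NF _)) // exprS -mulrA ler_wpM2l.
have Nx0 : N (x 0%N) ^+ 2 <=
    2 * N (dyn s) ^+ 2 + 2 * ((C * cd) ^+ 2 * (a ^+ 2 * e ^+ 2)).
  have ae : l1 (cplx (- (a *: (inp s - udes)))) = `|a| * e.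
    rewrite /e !l1_cplxE mulr_sumr; apply: eq_bigr => i _.
    by rewrite !mxE normrN normrM.
  have N1 : N (x 0%N) <= N (dyn s) + C * cd * (`|a| * e).
    rewrite /x /= movE /=; apply: le_trans (ND _ _) _; apply: lerD.
      by rewrite (le_trans (NF _)) // ler_piMl // ltW.
    have /andP[_ h] := NC (pDd P *m cplx (- (a *: (inp s - udes)))).
    apply: le_trans h _; rewrite -mulrA ler_wpM2l // -ae; exact: hd.
  have b0 : 0 <= C * cd * (`|a| * e) by rewrite !mulr_ge0.
  apply: (@le_trans _ _ ((N (dyn s) + C * cd * (`|a| * e)) ^+ 2)).
    by rewrite ler_pXn2r // nnegrE // addr_ge0.
  rewrite -[a ^+ 2]real_normK ?num_real // -!exprMn.
  by have := sqr_ge0 (N (dyn s) - C * cd * (`|a| * e)); nra.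
have sumY : (\sum_(0 <= j <oo)
    (quad (wQy W) (y_pred P s (move d) j - ysp d - slack_y d))%:E <=
    (K1 * N (x 0%N) ^+ 2)%:E)%E.
  have -> : K1 * N (x 0%N) ^+ 2 = cy * N (x 0%N) ^+ 2 / (1 - q).
    by rewrite /K1; ring.
  apply: nneseries_le_geometric => // j; rewrite quad_ge0 //=.
  rewrite output_error_target_step // quad_mulmx (le_trans (hy _)) // -mulrA.
  rewrite ler_wpM2l //; apply: (@le_trans _ _ (N (x j) ^+ 2)).
    rewrite ler_pXn2r ?nnegrE ?l1_ge0 //; apply: le_trans (l1_Re _) _.
    by case/andP: (NC (x j)).
  apply: (@le_trans _ _ ((q ^+ j * N (x 0%N)) ^+ 2)).
    by rewrite ler_pXn2r ?nnegrE ?mulr_ge0 ?exprn_ge0.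
  rewrite exprMn mulrC ler_wpM2l ?sqr_ge0 // expr2 ler_piMl ?exprn_ge0 //.
  by rewrite exprn_ile1 // ltW.
have sumU : (\sum_(0 <= j <oo)
    (quad (wQu W) (u_pred s (move d) j - udes - slack_u d))%:E = 0)%E.
  apply: eseries0 => j _ _; rewrite u_pred_target_step /=.
  have -> : (1 - a) *: inp s + a *: udes - udes - (1 - a) *: (inp s - udes) = 0.
    by apply/matrixP => i k; rewrite !mxE; ring.
  by rewrite quad0.
have sumR : \sum_(j < m) quad (wR W) (moves d j) <= cr * (a ^+ 2 * e ^+ 2).
  rewrite (bigD1 (Ordinal m_gt0)) //= big1 ?addr0 => [|[j jm] /= j0]; last first.
    by rewrite ifN ?quad0.
  rewrite -scalerN quadZ mulrCA ler_wpM2l ?sqr_ge0 //.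
  apply: le_trans (hr _) _; rewrite !l1_cplxE.
  by under eq_bigr do rewrite mxE normrN; rewrite -l1_cplxE.
rewrite /cost sumU adde0 !quadZ.
apply: (@le_trans _ _ ((K1 * N (x 0%N) ^+ 2)%:E +
  (\sum_(j < m) quad (wR W) (moves d j))%:E
  + ((1 - a) ^+ 2 * quad (wSy W) (pD0 P *m inp s - y))%:E
  + ((1 - a) ^+ 2 * quad (wSu W) (inp s - udes))%:E)%E).
  by rewrite !leeD2r.
clearbody K1; rewrite -!EFinD lee_fin.
have := ler_wpM2l K10 Nx0.
have : 0 <= K1 * (C * cd) ^+ 2 * N (dyn s) ^+ 2 by rewrite !mulr_ge0 ?sqr_ge0.
have : 0 <= cr * N (dyn s) ^+ 2 by rewrite !mulr_ge0 ?sqr_ge0.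
have : 0 <= K1 * (a ^+ 2 * e ^+ 2).
  by rewrite mulr_ge0 // mulr_ge0 // sqr_ge0.
move: sumR; set t := a ^+ 2 * _; lra.
Qed.

End TargetStep.

(** * Convergence of the closed loop *)

Lemma slacks_le_cost (R : realType) (nd nu ny m : nat) (P : plant R nd nu ny)
    (udes : 'cV[R]_nu) (W : weights R nu ny) s (d : decision R nu ny m) :
    posdef (wQy W) -> posdef (wQu W) -> posdef (wR W) ->
  ((quad (wSy W) (slack_y d) + quad (wSu W) (slack_u d))%:E
     <= cost P udes W s d)%E.
Proof.
move=> Qy_pos Qu_pos R_pos; rewrite /cost -addeA EFinD leeDr // !adde_ge0 //.
- by apply: nneseries_ge0 => j _ _; rewrite lee_fin quad_ge0.
- by apply: nneseries_ge0 => j _ _; rewrite lee_fin quad_ge0.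
- by rewrite lee_fin; apply: sumr_ge0 => j _; rewrite quad_ge0.
Qed.

Lemma nonincreasing_gap_cvg0 (R : realType) (V : R^nat) :
    (forall k, 0 <= V k) -> (forall k, V k.+1 <= V k) ->
  (V k - V k.+1) @[k --> \oo] --> (0 : R).
Proof.
move=> V0 VS; have /cvg_ex[L VL] : cvgn V.
  apply: nonincreasing_is_cvgn; first exact/nonincreasing_seqP.
  by exists 0 => _ [k _ <-].
by rewrite -(subrr L); apply: cvgB => //; rewrite (cvg_shiftS V).
Qed.

Section Convergence.
Variables (R : realType) (nd nu ny m : nat) (P : plant R nd nu ny).
Variables (U dU : set 'cV[R]_nu) (Y : set 'cV[R]_ny) (udes : 'cV[R]_nu).
Variable W : weights R nu ny.
Hypotheses (m_gt0 : (0 < m)%N).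
Hypotheses (U_rect : rectangle U) (U0 : U 0) (Uudes : U udes).
Hypotheses (Y_rect : rectangle Y) (Y0 : Y 0) (Yudes : Y (pD0 P *m udes)).
Hypothesis dU_nbhs0 : interior dU 0.
Hypotheses (Qy_pos : posdef (wQy W)) (Qu_pos : posdef (wQu W)).
Hypotheses (R_pos : posdef (wR W)).
Hypotheses (Sy_pos : posdef (wSy W)) (Su_pos : posdef (wSu W)).
Hypothesis F_stable : spectral_radius (pF P) < 1.
Variables (s : nat -> state R nd nu ny) (d : nat -> decision R nu ny m).
Hypothesis loop : closed_loop P U dU Y udes W s d.

Let s0 : s 0%N = State 0 0 0 := loop.1.

Let next_s k : s k.+1 = next_state P (s k) (move (d k.+1)) := (loop.2 k).2.

Let feas k : feasible P U dU Y udes (s k) (d k.+1) := (loop.2 k).1.1.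

Let opt k (d' : decision R nu ny m) : feasible P U dU Y udes (s k) d' ->
  (cost P udes W (s k) (d k.+1) <= cost P udes W (s k) d')%E.
Proof. exact: (loop.2 k).1.2. Qed.

Let dU0 : dU 0 := nbhs_singleton dU_nbhs0.

Let stat_s k : stat (s k) = pD0 P *m inp (s k).
Proof.
elim: k => [|k IH]; first by rewrite s0 /= mulmx0.
by rewrite next_s /next_state /= u_pred0 mulmxDr -IH.
Qed.

Let U_s k : U (inp (s k)).
Proof.
case: k => [|k]; first by rewrite s0.
by rewrite next_s /=; have [_ _ hU _ _] := feas k; apply: hU.
Qed.

Let V k : R := fine (cost P udes W (s k) (d k.+1)).

(* Up to sign, the motion that the plan intends after its first move; the input
   error of the first stage equals g, as the slack is the final input error. *)
Let g k : 'cV[R]_nu := inp (s k.+1) - u_pred (s k) (move (d k.+1)) m.-1.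

Let descent k : (cost P udes W (s k.+1) (d k.+2)
    + (quad (wQu W) (g k) + quad (wR W) (move (d k.+1) 0))%:E
  <= cost P udes W (s k) (d k.+1))%E.
Proof.
have := cost_shift P udes Qy_pos Qu_pos (s k) (d k.+1).
rewrite -next_s; apply: le_trans.
have -> : quad (wQu W)
      (u_pred (s k) (move (d k.+1)) 0 - udes - slack_u (d k.+1))
    = quad (wQu W) (g k).
  congr quad; have [_ /eqP + _ _ _] := feas k.
  rewrite subr_eq0 => /eqP <-; rewrite /g next_s /=.
  by rewrite opprB addrA addrNK.
rewrite leeD2r //; apply: opt.
by rewrite next_s; apply: feasible_shift => //; exact: feas.
Qed.

(* At rest, the step of fraction 0 has finite cost. *)
Let cost_fin k : cost P udes W (s k) (d k.+1) = (V k)%:E.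
Proof.
have cost_ge0 j : (0 <= cost P udes W (s j) (d j.+1))%E.
  apply: le_trans (slacks_le_cost _ _ _ _ Qy_pos Qu_pos R_pos).
  by rewrite lee_fin addr_ge0 ?quad_ge0.
suff : (cost P udes W (s k) (d k.+1) < +oo)%E.
  by move=> lty; rewrite fineK // ge0_fin_numE.
elim: k => [|k IH]; last first.
  apply: le_lt_trans IH; apply: le_trans (descent k).
  by rewrite leeDl // lee_fin addr_ge0 ?quad_ge0.
have [N [q [C [q01 C0 NC ND NF]]]] := stable_gauge F_stable.
have [K _ hK] := cost_target_step udes m_gt0 Qy_pos q01 C0 NC ND NF.
apply: le_lt_trans (opt (d' := target_step m P udes (s 0%N) 0 0) _) _.
  by apply: feasible_target_step => //; rewrite ?lexx ?ler01 // scale0r oppr0.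
by apply: le_lt_trans (hK _ _ _ (stat_s 0)) _; rewrite ltry.
Qed.

Lemma optimal_cost_cvg0 :
  cost P udes W (s k) (d k.+1) @[k --> \oo] --> 0%E.
Proof.
have V_ge0 k : 0 <= V k.
  rewrite -lee_fin -cost_fin.
  apply: le_trans (slacks_le_cost _ _ _ _ Qy_pos Qu_pos R_pos).
  by rewrite lee_fin addr_ge0 ?quad_ge0.
have stage k :
    quad (wQu W) (g k) + quad (wR W) (move (d k.+1) 0) <= V k - V k.+1.
  by have := descent k; rewrite !cost_fin -EFinD lee_fin; lra.
have Qg0 k : 0 <= quad (wQu W) (g k) by apply: quad_ge0.
have RD0 k : 0 <= quad (wR W) (move (d k.+1) 0) by apply: quad_ge0.
have gap0 : (V k - V k.+1) @[k --> \oo] --> (0 : R).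
  by apply: nonincreasing_gap_cvg0 => // k; have := stage k;
    have := Qg0 k; have := RD0 k; lra.
have [N [q [C [q01 C0 NC ND NF]]]] := stable_gauge F_stable.
have [q0 q1] := andP q01.
have N0 x : 0 <= N x.
  by case/andP: (NC x) => h _; apply: le_trans h; exact: l1_ge0.
(* The dynamic state is a stable filter of the vanishing moves.  The recursion
   is written for squares, since the stage costs bound squares; Young's
   inequality with weight 1 - q keeps the factor q, as q (2 - q) <= 1. *)
have dyn0 : (N (dyn (s k)) ^+ 2) @[k --> \oo] --> (0 : R).
  have [cd cd0 hd] := l1_mulmx (pDd P).
  have [cr cr0 hr] := posdef_coercive R_pos.
  pose c := (1 + (1 - q)^-1) * ((C * cd) ^+ 2 * cr).
  have c0 : 0 <= c.
    rewrite /c mulr_ge0 // ?mulr_ge0 ?sqr_ge0 // addr_ge0 // invr_ge0.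
    by rewrite subr_ge0 ltW.
  apply: (@cvg0_perturbed_contraction _ q _ (fun k => c * (V k - V k.+1))) => //.
  - by move=> k; apply: sqr_ge0.
  - move=> k; rewrite next_s /=; set b := l1 (cplx (move (d k.+1) 0)).
    have b0 : 0 <= b by apply: l1_ge0.
    set n := N (dyn (s k)); have n0 : 0 <= n by apply: N0.
    have h : N (pF P *m dyn (s k) + pDd P *m cplx (move (d k.+1) 0))
        <= q * n + C * cd * b.
      apply: le_trans (ND _ _) _; apply: lerD; first exact: NF.
      have /andP[_ h] := NC (pDd P *m cplx (move (d k.+1) 0)).
      by apply: le_trans h _; rewrite -mulrA ler_wpM2l //; exact: hd.
    have b2 : b ^+ 2 <= cr * (V k - V k.+1).
      apply: le_trans (hr _) _; rewrite ler_wpM2l //.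
      by have := stage k; have := Qg0 k; lra.
    apply: (@le_trans _ _ ((q * n + C * cd * b) ^+ 2)).
      by rewrite ler_pXn2r ?nnegrE ?addr_ge0 ?mulr_ge0.
    have young : (q * n + C * cd * b) ^+ 2 <=
        q * n ^+ 2 + (1 + (1 - q)^-1) * (C * cd * b) ^+ 2.
      set x := C * cd * b.
      have r0 : 0 < 1 - q by rewrite subr_gt0.
      have : 0 <= ((1 - q) * (q * n) - x) ^+ 2 / (1 - q).
        by rewrite divr_ge0 ?sqr_ge0 // ltW.
      have -> : ((1 - q) * (q * n) - x) ^+ 2 / (1 - q) =
          (1 - q) * (q * n) ^+ 2 - 2 * (q * n) * x + (1 - q)^-1 * x ^+ 2.
        by field; rewrite gt_eqF.
      have : 0 <= q * (1 - q) ^+ 2 * n ^+ 2.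
        by rewrite mulr_ge0 ?sqr_ge0 // mulr_ge0 // sqr_ge0.
      nra.
    apply: le_trans young _; rewrite lerD2l /c -[leRHS]mulrA ler_wpM2l //.
      by rewrite addr_ge0 // invr_ge0 subr_ge0 ltW.
    by rewrite exprMn -[leRHS]mulrA ler_wpM2l ?sqr_ge0.
  - by rewrite -(mulr0 c); apply: cvgMr.
have g0 : (l1 (cplx (g k)) ^+ 2) @[k --> \oo] --> (0 : R).
  have [c c0 hc] := posdef_coercive Qu_pos.
  have : (c * (V k - V k.+1)) @[k --> \oo] --> (0 : R).
    by rewrite -(mulr0 c); apply: cvgMr.
  apply: (@squeeze_cvgr _ _ _ _ (fun=> 0)); last exact: cvg_cst.
  apply: nearW => k; rewrite sqr_ge0 /= (le_trans (hc _)) // ler_wpM2l //.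
  by have := stage k; have := RD0 k; lra.
have [K K0 hK] := cost_target_step udes m_gt0 Qy_pos q01 C0 NC ND NF.
have [sigma sigma0 hsigma] := posdef_coercive Su_pos.
have [cy cy0 hy] := quad_le_l1 ((pD0 P)^T *m wSy W *m pD0 P).
have [cu cu0 hu] := quad_le_l1 (wSu W).
have [a0 a0_gt0 admissible] := uniform_admissible_step U_rect Uudes dU_nbhs0.
(* The bound on a makes its second-order cost 2 K sigma a ^ 2 at most half of
   the first-order gain a. *)
pose a := Num.min (Num.min 1 a0) (4 * (K * sigma) + 1)^-1.
have Ks0 : 0 <= K * sigma by rewrite mulr_ge0.
have a_gt0 : 0 < a.
  by rewrite /a !lt_min ltr01 a0_gt0 invr_gt0 ltr_wpDl // mulr_ge0.
have a_le1 : a <= 1 by rewrite /a !ge_min lexx.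
have a_lea0 : a <= a0 by rewrite /a !ge_min lexx orbT.
have aK : 2 * (K * sigma) * a ^+ 2 <= a / 2.
  have : a <= (4 * (K * sigma) + 1)^-1 by rewrite /a ge_min lexx orbT.
  rewrite -[_^-1]mul1r ler_pdivlMr ?ltr_wpDl ?mulr_ge0 // => h.
  have := ler_wpM2l (ltW a_gt0) h; nra.
pose c := 2 * K * a ^+ 2 + (1 + a^-1) * (cy + cu).
pose r k := K * N (dyn (s k.+1)) ^+ 2 + c * l1 (cplx (g k)) ^+ 2.
have r0 : r @ \oo --> 0.
  suff : r @ \oo --> K * 0 + c * 0 by rewrite !mulr0 addr0.
  apply: cvgD; apply: cvgMr => //.
  by rewrite (cvg_shiftS (fun k => N (dyn (s k)) ^+ 2)).
suff V0 : V @ \oo --> 0.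
  under eq_fun do rewrite cost_fin.
  by apply: cvg_EFin => //; exact: nearW.
apply: (@cvg0_perturbed_contraction _ (1 - a / 2) _ r) => //.
  by apply/andP; split; lra.
move=> k.
have [hx hu' _ _ hY] := feas k.
have eE : inp (s k.+1) - udes = slack_u (d k.+1) + g k.
  rewrite /g; move/eqP: hu'; rewrite subr_eq0 => /eqP <-.
  by apply/matrixP => i j; rewrite !mxE; ring.
have yE : pD0 P *m inp (s k.+1) - ysp (d k.+1) =
    slack_y (d k.+1) + pD0 P *m g k.
  rewrite /g mulmxBr -xs_predE //; move/eqP: hx; rewrite subr_eq0 => /eqP <-.
  by apply/matrixP => i j; rewrite !mxE; ring.
have step : V k.+1 <=
    K * (N (dyn (s k.+1)) ^+ 2 + a ^+ 2 * l1 (cplx (inp (s k.+1) - udes)) ^+ 2)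
     + (1 - a) ^+ 2 * (quad (wSy W) (pD0 P *m inp (s k.+1) - ysp (d k.+1))
                       + quad (wSu W) (inp (s k.+1) - udes)).
  rewrite -lee_fin -cost_fin; apply: le_trans (hK _ _ _ (stat_s k.+1)).
  apply: opt; apply: feasible_target_step => //; first by rewrite ltW.
  by apply: admissible => //; rewrite ltW.
have slack :
    quad (wSy W) (slack_y (d k.+1)) + quad (wSu W) (slack_u (d k.+1)) <= V k.
  by rewrite -lee_fin -cost_fin slacks_le_cost.
have := quad_young (slack_y (d k.+1)) (pD0 P *m g k) Sy_pos a_gt0.
have := quad_young (slack_u (d k.+1)) (g k) Su_pos a_gt0.
have l1e : l1 (cplx (inp (s k.+1) - udes)) ^+ 2 <=
    2 * (sigma * V k) + 2 * l1 (cplx (g k)) ^+ 2.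
  have : l1 (cplx (inp (s k.+1) - udes)) <=
      l1 (cplx (slack_u (d k.+1))) + l1 (cplx (g k)).
    by rewrite eE /cplx map_mxD l1D.
  have := hsigma (slack_u (d k.+1)).
  have : sigma * quad (wSu W) (slack_u (d k.+1)) <= sigma * V k.
    rewrite ler_wpM2l //; apply: le_trans slack; rewrite lerDr.
    exact: quad_ge0.
  have := l1_ge0 (cplx (inp (s k.+1) - udes)).
  have := l1_ge0 (cplx (g k)); have := l1_ge0 (cplx (slack_u (d k.+1))).
  set x := l1 _; set y := l1 _; set z := l1 _ => x0 y0 z0 h1 h2 h3.
  have : z ^+ 2 <= (x + y) ^+ 2 by rewrite ler_pXn2r ?nnegrE ?addr_ge0.
  have := sqr_ge0 (x - y); lra.
rewrite -eE -yE => hSu hSy.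
have hgu := hu (g k); have hgy := hy (g k); rewrite -quad_mulmx in hgy.
have K_term : K * (a ^+ 2 * l1 (cplx (inp (s k.+1) - udes)) ^+ 2) <=
    a / 2 * V k + 2 * K * a ^+ 2 * l1 (cplx (g k)) ^+ 2.
  have Ka0 : 0 <= K * a ^+ 2 by rewrite mulr_ge0 // sqr_ge0.
  have := ler_wpM2l Ka0 l1e; have := ler_wpM2r (V_ge0 k) aK; lra.
have S_term : (1 - a) ^+ 2 *
      (quad (wSy W) (pD0 P *m inp (s k.+1) - ysp (d k.+1))
       + quad (wSu W) (inp (s k.+1) - udes)) <=
    (1 - a) * V k + (1 + a^-1) * (cy + cu) * l1 (cplx (g k)) ^+ 2.
  have b0 : 0 <= 1 + a^-1 by rewrite addr_ge0 // invr_ge0 ltW.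
  set G := l1 (cplx (g k)) ^+ 2.
  have G0 : 0 <= (1 + a^-1) * (cy + cu) * G.
    by rewrite mulr_ge0 ?sqr_ge0 // mulr_ge0 // addr_ge0.
  apply: (@le_trans _ _
    ((1 - a) ^+ 2 * ((1 + a) * V k + (1 + a^-1) * (cy + cu) * G))).
    rewrite ler_wpM2l ?sqr_ge0 //.
    have := ler_wpM2l b0 hgu; have := ler_wpM2l b0 hgy.
    have a1 : 0 <= 1 + a by rewrite addr_ge0 // ltW.
    have := ler_wpM2l a1 slack; rewrite -/G; lra.
  (* (1 - a)^2 (1 + a) <= 1 - a: Young's inequality with weight a gives away
     only one of the two factors 1 - a. *)
  rewrite mulrDr; apply: lerD.
    have : 0 <= (1 - a) * a ^+ 2 * V k.
      by rewrite mulr_ge0 // mulr_ge0 ?sqr_ge0 // subr_ge0.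
    lra.
  rewrite ler_piMl // exprn_ile1 ?subr_ge0 //; lra.
by rewrite /r /c; lra.
Qed.

End Convergence.

Theorem theorem3p3 (R : realType) (nd nu ny m : nat) (P : plant R nd nu ny)
    (U dU : set 'cV[R]_nu) (Y : set 'cV[R]_ny) (udes : 'cV[R]_nu)
    (Qy Sy : 'M[R]_ny) (Qu Rdu : 'M[R]_nu)
    (hm : (1 <= m)%N)
    (hreal : real_output P)
    (hU : rectangle U) (hU0 : U 0)
    (hdU : rectangle dU) (hdU0 : interior dU 0)
    (hY : rectangle Y) (hY0 : Y 0)
    (hQy : posdef Qy) (hSy : posdef Sy) (hQu : posdef Qu) (hRdu : posdef Rdu)
    (hF : spectral_radius (pF P) < 1)
    (hudes : U udes) (hD0udes : Y (pD0 P *m udes)) :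
  exists S0 : 'M[R]_nu, posdef S0 /\
    forall Su : 'M[R]_nu, posdef Su -> loewner_lt S0 Su ->
    forall (s : nat -> state R nd nu ny) (d : nat -> decision R nu ny m),
      closed_loop P U dU Y udes (Weights Qy Qu Rdu Sy Su) s d ->
      (* This is V*_{k+1}: the optimal cost at time k + 1, posed from s k. *)
      cost P udes (Weights Qy Qu Rdu Sy Su) (s k) (d k.+1) @[k --> \oo] --> 0%E.
Proof.
(* The length of the target step adapts to Su, so any positive definite
   threshold will do. *)
exists Rdu; split=> // Su hSu _ s d loop.
exact: (optimal_cost_cvg0 hm hU hU0 hudes hY hY0 hD0udes hdU0
  _ _ _ _ _ hF loop).
Qed.
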